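(* Let $h(k,\lambda)$ be the expected time cost of one global iteration of BCFL and let $$\mathcal{J}^2(k,\lambda)=\frac{\Lambda_A^2\,h(k,\lambda)}{Y}+\frac{16\Lambda_B^2d^4}{Y^2}\left(\frac{h(k,\lambda)}{k^2}\right)^2+\frac{8\Lambda_A\Lambda_Bd^2}{Y^{3/2}}\left(\frac{h(k,\lambda)}{k^{4/3}}\right)^{3/2},$$ where $k$ is relaxed to be a real number, on the domain $0<k\le d$, $\lambda>0$ (the function $h$ and all constants are defined in the context). Then for each fixed $\lambda>0$, $\mathcal{J}^2(k,\lambda)$ is a convex function of $k$ on $0<k\le d$; and for each fixed $k$ with $0<k\le d$, $\mathcal{J}^2(k,\lambda)$ is a convex function of $\lambda$ on $\lambda>0$. Consequently the problem $$\min_{k,\lambda}\ \mathcal{J}^2(k,\lambda)\quad\text{s.t.}\quad 0<k\le d,\ \lambda>0$$ is a bi-convex optimization problem.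
   Context: System. There is a finite set $\mathcal{N}$ of $N$ clients and a finite set $\mathcal{M}$ of $M$ miners; each client is connected to one miner, and $N_j$ is the number of clients connected to miner $j$ (so $0\le N_j\le N$). $d\ge1$ is the model dimension, $s>0$ the number of bytes per model update, and $\omega=s+\frac{\lceil\log_2 d\rceil}{8}$. $k$ is the number of model updates kept by the compression algorithm and $\lambda$ is the block generation rate. $u_{\uparrow,i}>0$ and $u_{\downarrow,i}>0$ are the upload and download speeds of client $i$, and $u_j>0$ is the download speed of miner $j$. $j_w\in\mathcal{M}$ is the (fixed) winning miner, and $\mathcal{M}/j_w$ denotes $\mathcal{M}\setminus\{j_w\}$. The constants $\tau_{local},\tau_{aggre}\ge0$ are the local training time and the aggregation time. Block size: $\Omega=Nk\omega$. Time components: $\tau_{\uparrow,i}=\frac{k\omega}{u_{\uparrow,i}}$, $\tau_{cross,j}=\frac{(N-N_j)k\omega}{u_j}$, $\tau_{mine}=\frac1\lambda$, $\tau_{pro}=\max_{j\in\mathcal{M}/j_w}\frac{\Omega}{u_j}$, $\tau_{\downarrow,i}=\frac{\Omega}{u_{\downarrow,i}}$, and the forking probability is $p_{fork}=1-\exp\left(-\lambda\sum_{j\in\mathcal{M}/j_w}\frac{\Omega}{u_j}\right)$. The time cost of one global iteration is $$h(k,\lambda)=\tau_{local}+\tau_{aggre}+\max_{i\in\mathcal{N}}\tau_{\uparrow,i}+\max_{j\in\mathcal{M}}\tau_{cross,j}+\frac{\tau_{mine}+\tau_{pro}}{1-p_{fork}}+\max_{i\in\mathcal{N}}\tau_{\downarrow,i},$$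 where $$\frac{\tau_{mine}+\tau_{pro}}{1-p_{fork}}=\left(\frac1\lambda+\max_{j\in\mathcal{M}/j_w}\frac{\Omega}{u_j}\right)\exp\left(\lambda\sum_{j\in\mathcal{M}/j_w}\frac{\Omega}{u_j}\right).$$ Constants. $Y>0$ is the fixed total training time. $\Lambda_A,\Lambda_B\ge0$ are constants independent of $k$ and $\lambda$, namely $\Lambda_A=\frac{8}{\sqrt{E}}\left(\frac{\mathbb{E}[F(\mathbf{w}_0)]-F^*}{C}+2CL\Gamma_G^2+\frac{CL}{bN^2}\sum_i\sigma_i^2\right)$ and $\Lambda_B=16C^2L^2G^2E$, where $E,b$ are positive integers, $C,L>0$, $G,\Gamma_G,\sigma_i$ are real constants, and $F^*$ is the minimum value of the loss $F$, so $\mathbb{E}[F(\mathbf{w}_0)]\ge F^*$; only nonnegativity of $\Lambda_A,\Lambda_B$ matters here. A bi-convex optimization problem in $(k,\lambda)$ is the minimization, over a bi-convex feasible set (here a product of intervals), of a function that is convex in $k$ for each fixed feasible $\lambda$ and convex in $\lambda$ for each fixed feasible $k$. *)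

(* Defs.v *)
From HB Require Import structures.
From mathcomp Require Import all_boot all_order all_algebra.
From mathcomp Require Import all_classical all_reals all_analysis.

Set Implicit Arguments.
Unset Strict Implicit.
Unset Printing Implicit Defensive.

Import Order.TTheory GRing.Theory Num.Theory.
Import numFieldNormedType.Exports.

Local Open Scope classical_set_scope.
Local Open Scope ring_scope.

(* Data only: the sign conditions are hypotheses of the theorem. *)
Record bcfl (R : realType) := BCFL {
  client : finType;
  miner : finType;
  assoc : client -> miner;       (* the miner each client is connected to *)
  winner : miner;
  model_dim : nat;
  bytes : R;                     (* bytes per model update *)
  client_up : client -> R;
  client_down : client -> R;
  miner_down : miner -> R;
  tau_local : R;
  tau_aggre : R
}.

(* All maxima below are over families that are nonnegative on the domain
   0 < k, 0 < lam, where starting the iterated maximum from 0 does not change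
   its value; it only fixes the maximum of an empty family to be 0. *)
Section time_cost.
Context {R : realType} (S : bcfl R).
Implicit Types (k lam : R) (i : client S) (j : miner S).

Definition nclients : nat := #|client S|.

Definition nclients_of j : nat := #|[set i | assoc i == j]%SET|.

Definition omega : R :=
  bytes S + (Num.ceil (ln (model_dim S)%:R / ln 2 : R))%:~R / 8.

Definition block_size k : R := nclients%:R * k * omega.

Definition tau_up k i : R := k * omega / client_up i.

Definition tau_cross k j : R :=
  (nclients%:R - (nclients_of j)%:R) * k * omega / miner_down j.

Definition tau_mine lam : R := 1 / lam.

Definition tau_pro k : R :=
  \big[Num.max/0]_(j | j != winner S) (block_size k / miner_down j).

Definition tau_down k i : R := block_size k / client_down i.

Definition p_fork k lam : R :=
  1 - expR (- (lam * \sum_(j | j != winner S) block_size k / miner_down j)).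

Definition h k lam : R :=
  tau_local S + tau_aggre S
  + \big[Num.max/0]_i tau_up k i
  + \big[Num.max/0]_j tau_cross k j
  + (tau_mine lam + tau_pro k) / (1 - p_fork k lam)
  + \big[Num.max/0]_i tau_down k i.

Definition J2 (Y LambdaA LambdaB k lam : R) : R :=
  LambdaA ^+ 2 * h k lam / Y
  + 16 * LambdaB ^+ 2 * (model_dim S)%:R ^+ 4 / Y ^+ 2 * (h k lam / k ^+ 2) ^+ 2
  + 8 * LambdaA * LambdaB * (model_dim S)%:R ^+ 2 / (Y `^ (3 / 2))
    * (h k lam / (k `^ (4 / 3))) `^ (3 / 2).

(* EF0 stands for the expected loss E[F(w_0)] at the initial model, Fmin for
   the minimum F^* of the loss. *)
Definition Lambda_A (E b : nat) (C L GammaG : R) (sigma : client S -> R)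
    (EF0 Fmin : R) : R :=
  8 / Num.sqrt E%:R *
  ((EF0 - Fmin) / C + 2 * C * L * GammaG ^+ 2
   + C * L / (b%:R * nclients%:R ^+ 2) * \sum_i sigma i ^+ 2).

Definition Lambda_B (E : nat) (C L G : R) : R :=
  16 * C ^+ 2 * L ^+ 2 * G ^+ 2 * E%:R.

End time_cost.

Section biconvexity.
Context {R : realType}.

Record min_problem := MinProblem {
  objective : R * R -> R;
  feasible : set (R * R)
}.

Definition biconvex_set (B : set (R * R)) : Prop :=
  (forall x, convex_set (xsection B x : set R^o)) /\
  (forall y, convex_set (ysection B y : set R^o)).

Definition biconvex_function (B : set (R * R)) (f : R * R -> R) : Prop :=
  (forall y, convex_function (ysection B y : set R^o) (fun x => f (x, y))) /\
  (forall x, convex_function (xsection B x : set R^o) (fun y => f (x, y))).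

Definition biconvex_problem (p : min_problem) : Prop :=
  biconvex_set (feasible p) /\ biconvex_function (feasible p) (objective p).

End biconvexity.

(* Main.v *)
(* For 0 < k, h(k, lam) = a + c k + (1 / lam + m k) exp(lam B k) with a, c, m, B
   nonnegative. Hence, for p >= 1, h / k^p is in k a nonnegative combination of
   functions exp(b x) x^(-q) with b, q >= 0, and so is h in lam up to a constant;
   these functions are log-convex. As a function of k, h also contains the terms
   k and k exp(b k), which are convex. Finally y^q is convex and
   nondecreasing on y >= 0 for q >= 1, so (h / k^2)^2 and (h / k^(4/3))^(3/2)
   are convex in each variable. *)

Require Import Defs.
From HB Require Import structures.
From mathcomp Require Import all_boot all_order all_algebra.
From mathcomp Require Import all_classical all_reals all_analysis.
From mathcomp Require Import lra.

Set Implicit Arguments.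
Unset Strict Implicit.
Unset Printing Implicit Defensive.

Import Order.TTheory GRing.Theory Num.Theory.
Import numFieldNormedType.Exports.

Local Open Scope classical_set_scope.
Local Open Scope ring_scope.

(** * Closure properties of convex functions *)

Section convex_functions.
Context {R : realType} {E : lmodType R}.
Implicit Types (D : set (convex_lmodType E)) (f g : convex_lmodType E -> R^o).

Lemma sub_convex_function D D' f :
  D `<=` D' -> convex_function D' f -> convex_function D f.
Proof.
by move=> DD' cf t x y xD yD; apply: cf; rewrite inE; apply: DD'; rewrite -inE.
Qed.

(** Convexity of [D] lets the equation also be applied at the convex combination of two points. *)
Lemma eq_convex_function D f g :
  convex_set D -> {in D, f =1 g} -> convex_function D f -> convex_function D g.
Proof.
by move=> cD fg cf t x y xD yD; rewrite -!fg ?cf//; exact: cD.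
Qed.

Lemma convex_function_cst D (c : R) : convex_function D (fun=> c).
Proof. by move=> t x y _ _; rewrite convmm. Qed.

Lemma convex_functionD D f g :
  convex_function D f -> convex_function D g ->
  convex_function D (fun x => f x + g x).
Proof.
move=> cf cg t x y xD yD.
apply: le_trans (lerD (cf t x y xD yD) (cg t x y xD yD)) _.
by rewrite !convRE; lra.
Qed.

Lemma convex_functionZ D (c : R) f :
  0 <= c -> convex_function D f -> convex_function D (fun x => c * f x).
Proof.
move=> c0 cf t x y xD yD.
apply: le_trans (ler_wpM2l c0 (cf t x y xD yD)) _.
by rewrite !convRE; lra.
Qed.

(** On nonnegative reals the power map is nondecreasing and convex when [1 <= p]: monotonicity
    absorbs the convexity inequality of [f], and convexity of the power finishes. *)
Lemma convex_function_powR D f (p : R) : 1 <= p ->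
  convex_set D -> {in D, forall x, 0 <= f x} -> convex_function D f ->
  convex_function D (fun x => f x `^ p).
Proof.
move=> p1 cD f0 cf t x y xD yD.
have fx0 := f0 _ xD; have fy0 := f0 _ yD.
have conv0 : 0 <= conv t (f x) (f y).
  have t1 : 0 <= 1 - t%:num by rewrite subr_ge0.
  by rewrite convRE addr_ge0 ?mulr_ge0.
apply: (@le_trans _ _ (conv t (f x) (f y) `^ p)).
  apply: ge0_ler_powR; rewrite ?nnegrE.
  - exact: le_trans p1.
  - exact: f0 (cD _ _ _ xD yD).
  - exact: conv0.
  - exact: cf.
by apply: convex_powR; rewrite // inE/= in_itv/= ?fx0 ?fy0.
Qed.

End convex_functions.

(** * Convex functions of one positive real variable *)

Section convex_real.
Context {R : realType}.

(* [convRE] for [R^o] seen as an [lmodType]; the two structures are only convertible. *)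
Lemma conv_regularE (t : {i01 R}) (x y : convex_lmodType R^o) :
  conv t x y = t%:num * x + unstable.onem t%:num * y :> R.
Proof. by []. Qed.

Lemma convex_set_itv (i : interval R) : convex_set ([set` i] : set R^o).
Proof.
(* By symmetry of [conv] the endpoints may be ordered; the combination then lies between them. *)
suff H (x y : R^o) (t : {i01 R}) : x <= y ->
    x \in i -> y \in i -> conv t x y \in i.
  move=> x y t; rewrite !inE/= => xi yi.
  have [xy|/ltW yx] := leP x y; first exact: H.
  by rewrite convC; exact: H.
move=> xy xi yi.
exact: (@interval_is_interval _ i x y xi yi _ (convR_itv t xy)).
Qed.

(* [expR (c * x) * x `^ - p] is log-convex: its logarithm is [c * x - p * ln x]. *)
Lemma convex_expR_powRN (c p : R) : 0 <= p ->
  convex_function (`]0, +oo[ : set R^o) (fun x => expR (c * x) * x `^ (- p)).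
Proof.
move=> p0 t x y; rewrite !inE/= !in_itv/= !andbT => x0 y0.
have E (z : R) : 0 < z -> expR (c * z) * z `^ (- p) = expR (c * z - p * ln z).
  by move=> z0; rewrite /powR gt_eqF// -expRD mulNr.
rewrite !E ?convR_gt0//.
(* Convexity of [expR] leaves an inequality between exponents, which is concavity of [ln] scaled by
   [p]. *)
apply: le_trans (convex_expR t _ _); rewrite ler_expR.
have := ler_wpM2l p0 (concave_ln t x0 y0).
by rewrite !(convRE, conv_regularE); lra.
Qed.

(** The logarithm [ln x + c * x] is concave, so log-convexity is no help here; instead both factors
    are convex, nonnegative and nondecreasing. *)
Lemma convex_mul_expR (c : R) : 0 <= c ->
  convex_function (`]0, +oo[ : set R^o) (fun x => x * expR (c * x)).
Proof.
move=> c0 t x y; rewrite !inE/= !in_itv/= !andbT => x0 y0.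
have xy0 : 0 < conv t x y by rewrite convR_gt0.
have : expR (c * conv t x y) <= conv t (expR (c * x) : R^o) (expR (c * y)).
  apply: le_trans (convex_expR t _ _).
  by rewrite ler_expR !(convRE, conv_regularE); lra.
move=> /(ler_wpM2l (ltW xy0)) /le_trans; apply.
(* Chebyshev's sum inequality for the comonotone factors [x] and [expR (c * x)] *)
have : 0 <= (x - y) * (expR (c * x) - expR (c * y)).
  have [xy|/ltW yx] := leP x y.
    by rewrite mulr_le0// subr_le0// ler_expR ler_wpM2l.
  by rewrite mulr_ge0// subr_ge0// ler_expR ler_wpM2l.
have tt : 0 <= t%:num * (1 - t%:num) by rewrite mulr_ge0// subr_ge0.
move=> /(mulr_ge0 tt); rewrite !(convRE, conv_regularE) /unstable.onem.
move: (expR (c * x)) (expR (c * y)) (t%:num) => u v s.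
(* The right side minus the left side is [s * (1 - s) * (x - y) * (u - v)]. *)
by rewrite -subr_ge0 => H; rewrite -subr_ge0; lra.
Qed.

(** Scaling by a nonnegative [c] commutes with [Num.max] and fixes the starting value 0, so empty
    families are covered. *)
Lemma bigmax_mull (I : finType) (P : pred I) (f : I -> R) (c : R) : 0 <= c ->
  \big[Num.max/0]_(i | P i) (c * f i) = c * \big[Num.max/0]_(i | P i) f i.
Proof.
move=> c0; apply/esym; apply: (big_morph ( *%R c)); last exact: mulr0.
by move=> x y; exact: maxr_pMr.
Qed.

End convex_real.

(** * The time cost as a function of each variable *)

Section time_cost.
Context {R : realType} (S : bcfl R).
Hypotheses (dim_gt0 : (0 < model_dim S)%N) (bytes_gt0 : 0 < bytes S)
  (miner_down_gt0 : forall j : miner S, 0 < miner_down j)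
  (tau_local_ge0 : 0 <= tau_local S) (tau_aggre_ge0 : 0 <= tau_aggre S).

Lemma omega_gt0 : 0 < omega S.
Proof.
rewrite /omega ltr_wpDr// divr_ge0// ler0z.
rewrite -(ceil0 R) le_ceil// divr_ge0 ?ln_ge0 ?ler1n//.
Qed.

(** Every delay that depends on [k] is linear in it, so a nonnegative [k] can be pulled out of each
    maximum and of the sum in the forking exponent. Later proofs need only the signs of the four
    coefficients. *)
Lemma h_exp_affine : exists a c m B : R, [/\ 0 <= a, 0 <= c, 0 <= m, 0 <= B &
  forall k lam, 0 < k ->
  h S k lam = a + c * k + (lam^-1 + m * k) * expR (lam * B * k)].
Proof.
have w0 := ltW omega_gt0.
pose mx (I : finType) (P : pred I) (f : I -> R) := \big[Num.max/0]_(i | P i) f i.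
have mx0 I P f : 0 <= @mx I P f by exact: bigmax_ge_id.
pose cu := mx _ xpredT (fun i : client S => omega S / client_up i).
pose cc := mx _ xpredT (fun j : miner S =>
  ((nclients S)%:R - (nclients_of j)%:R) * omega S / miner_down j).
pose cd := mx _ xpredT (fun i : client S =>
  (nclients S)%:R * omega S / client_down i).
pose m := mx _ (fun j => j != winner S) (fun j : miner S =>
  (nclients S)%:R * omega S / miner_down j).
exists (tau_local S + tau_aggre S), (cu + cc + cd), m,
  (\sum_(j | j != winner S) (nclients S)%:R * omega S / miner_down j).
split; rewrite ?addr_ge0 ?mx0//.
  by apply: sumr_ge0 => j _; rewrite divr_ge0 ?mulr_ge0// ltW.
move=> k lam /ltW k0; rewrite /h.
have -> : \big[Num.max/0]_i @tau_up R S k i = k * cu.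
  by rewrite -bigmax_mull//; apply: eq_bigr => i _; rewrite /tau_up mulrA.
have -> : \big[Num.max/0]_j @tau_cross R S k j = k * cc.
  by rewrite -bigmax_mull//; apply: eq_bigr => j _; rewrite /tau_cross; lra.
have -> : \big[Num.max/0]_i @tau_down R S k i = k * cd.
  rewrite -bigmax_mull//; apply: eq_bigr => i _.
  by rewrite /tau_down /block_size; lra.
have -> : tau_pro S k = k * m.
  by rewrite -bigmax_mull//; apply: eq_bigr => j _; rewrite /block_size; lra.
have -> : p_fork S k lam = 1 - expR (- (lam *
    (\sum_(j | j != winner S) (nclients S)%:R * omega S / miner_down j) * k)).
  rewrite /p_fork -mulrA mulr_suml; congr (1 - expR (- (_ * _))).
  by apply: eq_bigr => j _; rewrite /block_size; lra.
(* Dividing by [1 - p_fork], an exponential of a negated argument, is multiplying by the opposite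
   exponential. *)
rewrite subKr expRN invrK /tau_mine div1r; lra.
Qed.

Lemma h_ge0 k lam : 0 < k -> 0 < lam -> 0 <= h S k lam.
Proof.
move=> k0 l0; have [a [c [m [B [a0 c0 m0 B0 ->//]]]]] := h_exp_affine.
by rewrite !(addr_ge0, mulr_ge0) ?expR_ge0 ?invr_ge0// ltW.
Qed.

Lemma convex_h_update lam : 0 < lam ->
  convex_function (`]0, +oo[ : set R^o) (fun k => h S k lam).
Proof.
move=> l0; have [a [c [m [B [a0 c0 m0 B0 hE]]]]] := h_exp_affine.
apply: (@eq_convex_function _ _ _ (fun k : R^o =>
  a + (c * (k * expR (0 * k)) + (lam^-1 * (expR (lam * B * k) * k `^ (- 0))
    + m * (k * expR (lam * B * k)))))).
- exact: convex_set_itv.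
- move=> k; rewrite inE/= in_itv/= andbT => k0; rewrite hE// oppr0 powRr0//.
  by rewrite mul0r expR0; lra.
- apply: convex_functionD; first exact: convex_function_cst.
  apply: convex_functionD.
    by apply: convex_functionZ => //; exact: convex_mul_expR.
  apply: convex_functionD.
    apply: convex_functionZ; rewrite ?invr_ge0 ?ltW//.
    exact: convex_expR_powRN.
  by apply: convex_functionZ => //; apply: convex_mul_expR; rewrite mulr_ge0// ltW.
Qed.

Lemma convex_h_div_powR_update (p lam : R) : 1 <= p -> 0 < lam ->
  convex_function (`]0, +oo[ : set R^o) (fun k => h S k lam / k `^ p).
Proof.
move=> p1 l0; have [a [c [m [B [a0 c0 m0 B0 hE]]]]] := h_exp_affine.
have p0 : 0 <= p by rewrite (le_trans ler01).
(* The terms linear in [k] become powers with exponent [- (p - 1)]; this is where [1 <= p] is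
   used. *)
apply: (@eq_convex_function _ _ _ (fun k : R^o =>
  a * (expR (0 * k) * k `^ (- p)) + (c * (expR (0 * k) * k `^ (- (p - 1)))
  + (lam^-1 * (expR (lam * B * k) * k `^ (- p))
    + m * (expR (lam * B * k) * k `^ (- (p - 1))))))).
- exact: convex_set_itv.
- move=> k; rewrite inE/= in_itv/= andbT => k0; rewrite hE//.
  have -> : k `^ (- (p - 1)) = k * k `^ (- p).
    by rewrite opprB powRD ?(gt_eqF k0) ?implybT// powRr1 ?(ltW k0).
  by rewrite powRN mul0r expR0; lra.
- do ?[apply: convex_functionD]; apply: convex_functionZ;
    rewrite ?invr_ge0 ?(ltW l0)//;
    by apply: convex_expR_powRN; rewrite ?subr_ge0.
Qed.

Lemma convex_h_rate k : 0 < k ->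
  convex_function (`]0, +oo[ : set R^o) (fun lam => h S k lam).
Proof.
move=> k0; have [a [c [m [B [a0 c0 m0 B0 hE]]]]] := h_exp_affine.
apply: (@eq_convex_function _ _ _ (fun lam : R^o =>
  (a + c * k) + (1 * (expR (B * k * lam) * lam `^ (- 1))
    + m * k * (expR (B * k * lam) * lam `^ (- 0))))).
- exact: convex_set_itv.
- move=> lam; rewrite inE/= in_itv/= andbT => l0; rewrite hE//.
  rewrite oppr0 powRr0 powR_inv1 ?ltW//.
  by rewrite (_ : B * k * lam = lam * B * k); lra.
- apply: convex_functionD; first exact: convex_function_cst.
  apply: convex_functionD; apply: convex_functionZ;
    rewrite ?mulr_ge0 ?(ltW k0)//; exact: convex_expR_powRN.
Qed.

(** Both variables are functions of one parameter, so taking one as the identity and the other as a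
    constant gives either half of the biconvexity. *)
Lemma convex_J2 (A B Y : R) (i : interval R) (k lam : R -> R) :
  0 <= A -> 0 <= B -> 0 < Y ->
  {in i, forall x, 0 < k x /\ 0 < lam x} ->
  convex_function ([set` i] : set R^o) (fun x => h S (k x) (lam x)) ->
  (forall p, 1 <= p ->
    convex_function ([set` i] : set R^o) (fun x => h S (k x) (lam x) / k x `^ p)) ->
  convex_function ([set` i] : set R^o) (fun x => J2 S Y A B (k x) (lam x)).
Proof.
move=> A0 B0 Y0 pos ch chp.
have cD : convex_set ([set` i] : set R^o) by exact: convex_set_itv.
(* The squares are rewritten as real powers, so that [pow] below treats both nonlinear terms; the
   conversion relies on nonnegative bases. *)
apply: (@eq_convex_function _ _ _ (fun x : R^o =>
  (A ^+ 2 / Y * h S (k x) (lam x)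
   + (16 * B ^+ 2 * (model_dim S)%:R ^+ 4 / Y ^+ 2)
     * (h S (k x) (lam x) / k x `^ 2) `^ 2)
   + (8 * A * B * (model_dim S)%:R ^+ 2 / Y `^ (3 / 2))
     * (h S (k x) (lam x) / k x `^ (4 / 3)) `^ (3 / 2))) => //.
  move=> x; rewrite inE/= => /pos[k0 l0]; rewrite /J2.
  rewrite !powR_mulrn ?divr_ge0 ?h_ge0 ?exprn_ge0 ?(ltW k0)//.
  by rewrite mulrAC.
have pow p q : 1 <= p -> 1 <= q -> convex_function ([set` i] : set R^o)
    (fun x => (h S (k x) (lam x) / k x `^ p) `^ q).
  move=> p1 q1; apply: convex_function_powR => //; last exact: chp.
  by move=> x; rewrite inE/= => /pos[k0 l0]; rewrite divr_ge0 ?powR_ge0 ?h_ge0.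
do ?[apply: convex_functionD]; apply: convex_functionZ;
  rewrite ?(exprn_ge0, divr_ge0, mulr_ge0, powR_ge0, ltW Y0)//;
  by apply: pow; lra.
Qed.

End time_cost.

(** * Signs of the constants *)

Lemma Lambda_B_ge0 (R : realType) (E : nat) (C L G : R) :
  0 <= Lambda_B E C L G.
Proof. by rewrite /Lambda_B ?(sqr_ge0, mulr_ge0). Qed.

Lemma Lambda_A_ge0 (R : realType) (S : bcfl R) (E b : nat)
    (C L GammaG : R) (sigma : client S -> R) (EF0 Fmin : R) :
  0 <= C -> 0 <= L -> Fmin <= EF0 ->
  0 <= Lambda_A E b C L GammaG sigma EF0 Fmin.
Proof.
move=> C0 L0 le; have sum0 : 0 <= \sum_i sigma i ^+ 2.
  by apply: sumr_ge0 => i _; exact: sqr_ge0.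
have F0 : 0 <= EF0 - Fmin by rewrite subr_ge0.
by rewrite /Lambda_A !(F0, sqr_ge0, addr_ge0, divr_ge0, mulr_ge0, sqrtr_ge0).
Qed.

Lemma expectation_ge (R : realType) (disp : measure_display)
    (T : measurableType disp) (P : probability T R) (X : T -> R) (c : R) :
  P.-integrable setT (EFin \o X) -> (forall x, c <= X x) ->
  c <= fine ('E_P[X])%E.
Proof.
(* Integrability makes the expectation finite, so [fine] keeps its value. *)
move=> iX cX; rewrite -lee_fin fineK; last first.
  by rewrite expectation_fin_num// inE; exact/Lfun1_integrable.
rewrite -(expectation_cst P c) unlock; apply: le_integral => //.
  exact: finite_measure_integrable_cst.
by move=> x _; rewrite lee_fin.
Qed.

(** * Biconvex problems on a product set *)

Lemma convex_set0 (R : realType) (E : lmodType R) :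
  convex_set (set0 : set (convex_lmodType E)).
Proof. by move=> x y t; rewrite inE. Qed.

Lemma convex_function_set0 (R : realType) (E : lmodType R)
  (f : convex_lmodType E -> R^o) : convex_function set0 f.
Proof. by move=> t x y; rewrite inE. Qed.

(** A section of a product is either the other factor or empty, and the empty case is trivial. *)
Lemma biconvex_problem_setX (R : realType) (A B : set R) (f : R * R -> R) :
  convex_set (A : set R^o) -> convex_set (B : set R^o) ->
  (forall y, B y -> convex_function (A : set R^o) (fun x => f (x, y))) ->
  (forall x, A x -> convex_function (B : set R^o) (fun y => f (x, y))) ->
  biconvex_problem (MinProblem f (A `*` B)).
Proof.
move=> cA cB fA fB; split; split => z /=.
- have [zA|zA] := boolP (z \in A); first by rewrite in_xsectionX.
  by rewrite notin_xsectionX//; exact: convex_set0.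
- have [zB|zB] := boolP (z \in B); first by rewrite in_ysectionX.
  by rewrite notin_ysectionX//; exact: convex_set0.
- have [zB|zB] := boolP (z \in B); last first.
    by rewrite notin_ysectionX//; exact: convex_function_set0.
  by rewrite in_ysectionX//; apply: fA; rewrite -inE.
- have [zA|zA] := boolP (z \in A); last first.
    by rewrite notin_xsectionX//; exact: convex_function_set0.
  by rewrite in_xsectionX//; apply: fB; rewrite -inE.
Qed.

Theorem theorem2 (R : realType) (S : bcfl R)
  (dim_gt0 : (0 < model_dim S)%N) (bytes_gt0 : 0 < bytes S)
  (client_up_gt0 : forall i : client S, 0 < client_up i)
  (client_down_gt0 : forall i : client S, 0 < client_down i)
  (miner_down_gt0 : forall j : miner S, 0 < miner_down j)
  (tau_local_ge0 : 0 <= tau_local S) (tau_aggre_ge0 : 0 <= tau_aggre S)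
  (disp : measure_display) (T : measurableType disp) (P : probability T R)
  (F : 'rV[R]_(model_dim S) -> R) (w0 : T -> 'rV[R]_(model_dim S)) (Fmin : R)
  (Fmin_attained : exists w, F w = Fmin) (Fmin_le : forall w, Fmin <= F w)
  (Fw0_integrable : P.-integrable setT (EFin \o (F \o w0)))
  (E b : nat) (E_gt0 : (0 < E)%N) (b_gt0 : (0 < b)%N)
  (C L G GammaG : R) (C_gt0 : 0 < C) (L_gt0 : 0 < L)
  (sigma : client S -> R) (Y : R) (Y_gt0 : 0 < Y) :
  let LambdaA := Lambda_A E b C L GammaG sigma (fine ('E_P[F \o w0])%E) Fmin in
  let LambdaB := Lambda_B E C L G in
  let J2 := J2 S Y LambdaA LambdaB in
  let K : set R := `]0, (model_dim S)%:R]%classic in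
  let Lam : set R := `]0, +oo[%classic in
  [/\ forall lam : R, 0 < lam ->
        convex_function (K : set R^o) (fun k => J2 k lam),
      forall k : R, 0 < k <= (model_dim S)%:R ->
        convex_function (Lam : set R^o) (fun lam => J2 k lam)
    & biconvex_problem (MinProblem (fun x => J2 x.1 x.2) (K `*` Lam))].
Proof.
move=> LambdaA LambdaB.
have A0 : 0 <= LambdaA.
  apply: Lambda_A_ge0; [exact: ltW|exact: ltW|].
  by apply: expectation_ge => // x; exact: Fmin_le.
have B0 : 0 <= LambdaB by exact: Lambda_B_ge0.
(* From here on only the signs of the two constants are known. *)
clearbody LambdaA LambdaB => J K Lam.
have convJ := convex_J2 dim_gt0 bytes_gt0 miner_down_gt0 tau_local_ge0
  tau_aggre_ge0 A0 B0 Y_gt0.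
have convK lam : 0 < lam -> convex_function (K : set R^o) (fun k => J k lam).
  move=> l0; have KP : K `<=` `]0, +oo[%classic.
    by move=> k; rewrite /K/= !in_itv/= andbT => /andP[].
  apply: (convJ _ id (fun=> lam)).
  - by move=> k; rewrite in_itv/= => /andP[].
  - by apply: sub_convex_function KP _; exact: convex_h_update.
  - move=> p p1.
    by apply: sub_convex_function KP _; exact: convex_h_div_powR_update.
have convLam k : 0 < k -> convex_function (Lam : set R^o) (fun lam => J k lam).
  move=> k0; apply: (convJ _ (fun=> k) id).
  - by move=> lam; rewrite in_itv/= andbT.
  - exact: convex_h_rate.
  (* With [k] fixed, dividing by its power is scaling by a nonnegative constant. *)
  - move=> p p1; apply: (@eq_convex_function _ _ _
      (fun lam : R^o => (k `^ p)^-1 * h S k lam)).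
    + exact: convex_set_itv.
    + by move=> lam _; rewrite mulrC.
    + by apply: convex_functionZ; rewrite ?invr_ge0 ?powR_ge0//;
        exact: convex_h_rate.
split; [exact: convK|by move=> k /andP[k0 _]; exact: convLam|].
apply: biconvex_problem_setX.
- exact: convex_set_itv.
- exact: convex_set_itv.
- by move=> lam; rewrite /Lam/= in_itv/= andbT; exact: convK.
- by move=> k; rewrite /K/= in_itv/= => /andP[k0 _]; exact: convLam.
Qed.
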